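(* For every $L$ there is a $K$ such that every finite poset $P$ with $\pi(P)>K$ satisfies $\sigma(P)>L$. (In the notation $\chi\leadsto\vartheta$, meaning that $\vartheta(P)\to\infty$ whenever $\chi(P)\to\infty$: $\pi\leadsto\sigma$.)
   Context: All posets are finite. For an $n$-element poset $P$, a linear extension is an order-preserving bijection $f:P\to[n]=\{1,\dots,n\}$, and $f$ denotes a uniformly random linear extension of $P$. For $x\in P$, $\sigma(x)$ is the standard deviation of $f(x)$, and $\sigma(P)=\max_{x\in P}\sigma(x)$. Elements $x,y$ are comparable if $x<y$ or $y<x$. For $x\in P$, $\Pi(x)$ is the set of elements of $P$ incomparable to $x$, $\pi(x)=|\Pi(x)|$, and $\pi(P)=\max_{x\in P}\pi(x)$. *)

(* Defs.v *)
From HB Require Import structures.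
From mathcomp Require Import all_boot all_order all_algebra.
From mathcomp Require Import reals.

Set Implicit Arguments.
Unset Strict Implicit.
Unset Printing Implicit Defensive.

Import Order.TTheory GRing.Theory Num.Theory.

Local Open Scope ring_scope.

Section LinearExtensions.
Variables (d : Order.disp_t) (P : finPOrderType d).

(* An injection between the equinumerous types P and 'I_#|P| is a bijection;
   see linear_extensionP. *)
Definition linear_extension (f : {ffun P -> 'I_#|P|}) : bool :=
  injectiveb f && [forall x, forall y, (x < y)%O ==> (f x < f y)%N].

Lemma linear_extensionP (f : {ffun P -> 'I_#|P|}) :
  reflect (bijective f /\ forall x y : P, (x < y)%O -> (f x < f y)%N)
          (linear_extension f).
Proof.
apply: (iffP andP) => [[/injectiveP f_inj /forallP f_mono] | [f_bij f_mono]].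
  split; first by apply: inj_card_bij => //; rewrite card_ord.
  by move=> x y; move/forallP: (f_mono x) => /(_ y) /implyP.
split; first by apply/injectiveP; exact: bij_inj.
by apply/forallP=> x; apply/forallP=> y; apply/implyP; exact: f_mono.
Qed.

Definition linear_extensions : {set {ffun P -> 'I_#|P|}} :=
  [set f | linear_extension f].

(* The successor moves the values of f from {0, ..., n - 1} to {1, ..., n}. *)
Definition height (f : {ffun P -> 'I_#|P|}) (x : P) : nat := (f x).+1.

Section StandardDeviation.
Variable R : realType.

(* Expectation over a uniformly random linear extension. *)
Definition expectation (X : {ffun P -> 'I_#|P|} -> R) : R :=
  (\sum_(f in linear_extensions) X f) / #|linear_extensions|%:R.

Definition mean_height (x : P) : R :=
  expectation (fun f => (height f x)%:R).

Definition variance_height (x : P) : R :=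
  expectation (fun f => ((height f x)%:R - mean_height x) ^+ 2).

Definition sigma_elt (x : P) : R := Num.sqrt (variance_height x).

(* Each sigma_elt x is nonnegative, so the default value 0 only matters when
   P is empty. *)
Definition sigma_poset : R := \big[Order.max/0]_(x : P) sigma_elt x.

End StandardDeviation.

(* Library incomparability is defined from <=, so x is not in
   incomparables x. *)
Definition incomparables (x : P) : {set P} := [set y | (x >< y)%O].

Definition pi_elt (x : P) : nat := #|incomparables x|.

Definition pi_poset : nat := (\max_(x : P) pi_elt x)%N.

End LinearExtensions.

Arguments sigma_poset {d} P R.
Arguments pi_poset {d} P.

(* Main.v *)
Require Import Defs.
From mathcomp Require Import all_boot all_order all_algebra.
From mathcomp Require Import reals.
From mathcomp Require Import fingroup perm zify ring lra.

Set Implicit Arguments.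
Unset Strict Implicit.
Unset Printing Implicit Defensive.

Import Order.TTheory GRing.Theory Num.Theory.

Local Open Scope ring_scope.

(* Suppose that every height has variance at most V.

   Since f is a bijection, the sum over z of E[1 / (1 + (f z - k)^2)] is bounded
   by an absolute constant for every k, while by Jensen each term is at least
   1 / (1 + V + (h z - k)^2), where h z is the mean of f z.  Hence few elements
   have mean height near that of x, so an x with many incomparable elements has
   an incomparable y whose mean height is far away, say far above h x (else
   exchange x and y).

   Let U be the up-set of x, so that y is not in U, and let W = f(U).  Let S_k be
   the number of positions of W below k; by the same kernel estimate, the S_k
   have L1 deviations bounded in terms of V.  If p is in W, q is not, and p < q,
   then replacing p by q in W (keeping the relative orders of U and of its
   complement) never violates an order relation, so W - p + q is the image of U
   for at least as many linear extensions as W.  In particular the density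
   P(p in W) is nondecreasing in p.  It is bounded below from about h x on, as x
   is in U, and bounded away from 1 up to about h y, as y is not, so between h x
   and h y there are two adjacent long windows on which the density is bounded
   away from 0 and 1 and nearly constant.  Moving one element of W from the first
   window to the second decreases by 1 the count S at their common boundary, and
   there are nearly as many ways to undo such a move.  So lowering S by 1 almost
   preserves its law, contradicting its bounded deviations; the contradiction
   is extracted by testing against a decreasing clamp function of S. *)

(** * Existence of linear extensions *)

Section Existence.
Variables (d : Order.disp_t) (P : finPOrderType d).

(** Principal down-sets grow strictly along the order, so sorting by their size, ties broken by
    enumeration rank, gives a linear extension: [f] counts the smaller keys. *)
Lemma linear_extensions_gt0 : (0 < #|linear_extensions P|)%N.
Proof.
pose key (x : P) := (#|[set z : P | (z <= x)%O]| * #|P| + enum_rank x)%N.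
have rank_lt (x : P) : (enum_rank x < #|P|)%N by apply: ltn_ord.
have key_inj : injective key.
  move=> x y /(congr1 (modn^~ #|P|)); rewrite /key !modnMDl !modn_small //.
  by move=> /val_inj /enum_rank_inj.
have key_mono x y : (x < y)%O -> (key x < key y)%N.
  move=> xy; have : (#|[set z : P | (z <= x)%O]| < #|[set z : P | (z <= y)%O]|)%N.
    apply/proper_card/properP; split.
      by apply/subsetP=> z; rewrite !inE => /le_trans; apply; exact: ltW.
    by exists y; rewrite !inE ?lexx // lt_geF.
  move=> lt_xy; rewrite /key.
  apply: (@leq_trans (#|[set z : P | (z <= x)%O]|.+1 * #|P|)).
    by rewrite mulSn addnC ltn_add2r.
  by apply: leq_trans (leq_addr _ _); rewrite leq_mul2r lt_xy orbT.
have below_lt (x : P) : (#|[set z : P | (key z < key x)%N]| < #|P|)%N.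
  rewrite -cardsT; apply/proper_card/properP; split; first exact: subsetT.
  by exists x; rewrite !inE ?ltnn.
pose f := [ffun x : P => Ordinal (below_lt x)].
have f_mono x y : (key x < key y)%N -> (f x < f y)%N.
  move=> xy; rewrite !ffunE /=; apply/proper_card/properP; split.
    by apply/subsetP=> z; rewrite !inE => /ltn_trans; apply.
  by exists x; rewrite !inE ?ltnn.
apply/card_gt0P; exists f; rewrite inE; apply/andP; split.
  apply/injectiveP=> x y fxy; apply: key_inj.
  by case: (ltngtP (key x) (key y)) => // /f_mono; rewrite fxy ltnn.
apply/forallP=> x; apply/forallP=> y; apply/implyP=> xy.
exact/f_mono/key_mono.
Qed.

End Existence.

(** * Expectation over a random linear extension *)

Section Expectation.
Variables (R : realType) (d : Order.disp_t) (P : finPOrderType d).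
Implicit Types X Y : {ffun P -> 'I_#|P|} -> R.

Lemma eq_expectation X Y : (forall f, f \in linear_extensions P -> X f = Y f) ->
  expectation X = expectation Y.
Proof. by move=> XY; rewrite /expectation; congr (_ / _); apply: eq_bigr. Qed.

Lemma expectationD X Y :
  expectation (fun f => X f + Y f) = expectation X + expectation Y.
Proof. by rewrite /expectation big_split mulrDl. Qed.

Lemma expectationZ c X : expectation (fun f => c * X f) = c * expectation X.
Proof. by rewrite /expectation -mulr_sumr mulrA. Qed.

Lemma expectationB X Y :
  expectation (fun f => X f - Y f) = expectation X - expectation Y.
Proof. by rewrite /expectation sumrB mulrBl. Qed.

Lemma expectation_sum (I : finType) (A : pred I)
    (X : I -> {ffun P -> 'I_#|P|} -> R) :
  expectation (fun f => \sum_(i | A i) X i f) = \sum_(i | A i) expectation (X i).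
Proof. by rewrite /expectation exchange_big mulr_suml. Qed.

Lemma expectation_cst c : expectation (fun _ : {ffun P -> 'I_#|P|} => c) = c :> R.
Proof.
rewrite /expectation sumr_const -[c *+ _]mulr_natr mulfK //.
by rewrite pnatr_eq0 -lt0n linear_extensions_gt0.
Qed.

Lemma ler_expectation X Y :
    (forall f, f \in linear_extensions P -> X f <= Y f) ->
  expectation X <= expectation Y.
Proof. by move=> XY; rewrite ler_pM2r ?ler_sum // invr_gt0 ltr0n linear_extensions_gt0. Qed.

Lemma normr_expectation X : `|expectation X| <= expectation (fun f => `|X f|).
Proof.
rewrite /expectation normrM [`|_^-1|]ger0_norm ?invr_ge0 ?ler0n //.
by rewrite ler_wpM2r ?invr_ge0 ?ler0n // ler_norm_sum.
Qed.

End Expectation.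

(** * Moving one position of the image of an up-set *)

Section UpSet.
Variables (R : realType) (d : Order.disp_t) (P : finPOrderType d) (U : {set P}).
Hypothesis U_up : forall x y : P, (x < y)%O -> x \in U -> y \in U.

Let fibre (W : {set 'I_#|P|}) := [set f in linear_extensions P | f @: U == W].

Lemma tperm_imset (T : finType) (p q : T) (W : {set T}) :
  p \in W -> q \notin W -> tperm p q @: W = q |: W :\ p.
Proof.
move=> pW qW; apply/setP=> z; rewrite !inE -[z in LHS](tpermK p q).
rewrite mem_imset; last exact: perm_inj.
case: tpermP => [->|->|/eqP zp /eqP zq]; rewrite ?eqxx ?pW ?(negPf qW).
- by rewrite orbF; apply/esym/negbTE; apply: contraNneq qW => <-.
- by [].
by rewrite (negPf zp) (negPf zq).
Qed.

(** Exchanging the elements at [p] and [p + 1] is injective and could only break a relation between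
    these two. The lower one is in [U] and the upper one is not, so up-closure excludes that
    relation. *)
Lemma card_fibre_adjacent (W : {set 'I_#|P|}) (p q : 'I_#|P|) :
    q = p.+1 :> nat -> p \in W -> q \notin W ->
  (#|fibre W| <= #|fibre (tperm p q @: W)|)%N.
Proof.
move=> qp pW qW.
pose s (f : {ffun P -> 'I_#|P|}) := [ffun x => tperm p q (f x)].
have s_inj : injective s.
  move=> f g fg; apply/ffunP=> x; apply: (@perm_inj _ (tperm p q)).
  by move/ffunP/(_ x): fg; rewrite !ffunE.
rewrite -(card_imset _ s_inj); apply/subset_leq_card/subsetP=> _ /imsetP[f + ->].
rewrite !inE => /andP[/linear_extensionP[f_bij f_mono] /eqP fU].
have f_inj := bij_inj f_bij.
apply/andP; split; last first.
  apply/eqP; rewrite -fU -imset_comp; apply: eq_imset => x /=.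
  by rewrite ffunE.
apply/linear_extensionP; split.
  apply: inj_card_bij; last by rewrite card_ord.
  by move=> x y; rewrite !ffunE => /perm_inj/f_inj.
move=> x y xy; rewrite !ffunE; have fxy := f_mono _ _ xy.
have not_pq : ~~ ((f x == p :> nat) && (f y == q :> nat)).
  apply/negP=> /andP[/eqP/val_inj fx /eqP/val_inj fy].
  move: pW qW; rewrite -fx -fy -fU !mem_imset // => xU.
  by rewrite (U_up xy xU).
have val_tperm (z : 'I_#|P|) : tperm p q z =
    (if z == p :> nat then p.+1 else if z == p.+1 :> nat then p : nat else z)%N :> nat.
  rewrite -qp; case: tpermP => [->|->|/eqP zp /eqP zq]; rewrite ?eqxx //.
    by rewrite qp gtn_eqF.
  by move: zp zq; rewrite -!(inj_eq val_inj) => /negPf -> /negPf ->.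
move: fxy not_pq; rewrite !val_tperm qp.
move: (nat_of_ord (f x)) (nat_of_ord (f y)) (nat_of_ord p) => a b c.
by do ![case: ifP]; lia.
Qed.

Lemma card_fibre_swap (W : {set 'I_#|P|}) (p q : 'I_#|P|) :
    (p < q)%N -> p \in W -> q \notin W ->
  (#|fibre W| <= #|fibre (tperm p q @: W)|)%N.
Proof.
move: {2}(q - p)%N (leqnn (q - p)%N) => m; elim: m p W => [|m IHm] p W.
  by rewrite leqn0 subn_eq0 leqNgt => /negbTE ->.
move=> qpm pq pW qW.
have p1_lt : (p.+1 < #|P|)%N by apply: leq_ltn_trans (ltn_ord q).
pose r := Ordinal p1_lt.
have [qr|qr] := eqVneq q r; first by apply: card_fibre_adjacent => //; rewrite qr.
have rq : (r < q)%N by rewrite ltn_neqAle val_eqE eq_sym qr.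
have pr : p != r by rewrite -val_eqE neq_ltn ltnSn.
have pq' : p != q by rewrite -val_eqE neq_ltn pq.
have qrm : (q - r <= m)%N by rewrite subnS -subn1 leq_subLR add1n.
rewrite (tperm_imset pW qW).
(* If [r] is in [W], it moves to [q] first and [p] then takes its place; otherwise [p] moves to [r]
   and from there to [q]. Both orders end at [W - p + q]. *)
have [rW|rW] := boolP (r \in W).
  apply: (leq_trans (IHm r W qrm rq rW qW)).
  have pW1 : p \in tperm r q @: W by rewrite tperm_imset // !inE pW pr orbT.
  have rW1 : r \notin tperm r q @: W.
    by rewrite tperm_imset // !inE eqxx orbF eq_sym.
  apply: leq_trans (card_fibre_adjacent _ pW1 rW1) _ => //.
  rewrite (tperm_imset pW1 rW1) (tperm_imset rW qW).
  suff -> : r |: (q |: W :\ r) :\ p = q |: W :\ p by [].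
  apply/setP=> z; rewrite !inE.
  have [->|zr] := eqVneq z r; first by rewrite rW eq_sym pr orbT.
  have [->|zq] := eqVneq z q; first by rewrite eq_sym pq'.
  by [].
apply: leq_trans (card_fibre_adjacent _ pW rW) _ => //.
have rW1 : r \in tperm p r @: W by rewrite tperm_imset // !inE eqxx.
have qW1 : q \notin tperm p r @: W.
  by rewrite tperm_imset // !inE (negPf qW) andbF orbF.
apply: (leq_trans (IHm r _ qrm rq rW1 qW1)).
rewrite (tperm_imset rW1 qW1) (tperm_imset pW rW).
suff -> : q |: (r |: W :\ p) :\ r = q |: W :\ p by [].
apply/setP=> z; rewrite !inE.
have [->|zr] := eqVneq z r; first by rewrite (negPf rW) andbF.
by [].
Qed.

Lemma expectation_fibre (Phi : {set 'I_#|P|} -> R) :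
  expectation (fun f : {ffun P -> 'I_#|P|} => Phi (f @: U)) =
  (\sum_W #|fibre W|%:R * Phi W) / #|linear_extensions P|%:R.
Proof.
rewrite /expectation; congr (_ / _).
rewrite (partition_big (fun f : {ffun P -> 'I_#|P|} => f @: U) predT) //=.
apply: eq_bigr => W _.
rewrite (eq_bigr (fun=> Phi W)); last by move=> f /andP[_ /eqP ->].
rewrite sumr_const mulr_natl; congr (_ *+ _).
by apply: eq_card => f; rewrite [RHS]inE unfold_in.
Qed.

(** Weighted form of the fibre comparison. Reindexing the right side by the transposition makes both
    sides weigh each [W] by [Phi] of the moved set. *)
Lemma expectation_swap (Phi : {set 'I_#|P|} -> R) (p q : 'I_#|P|) :
    (forall W, 0 <= Phi W) -> (p < q)%N ->
  expectation (fun f : {ffun P -> 'I_#|P|} =>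
    (p \in f @: U)%:R * (q \notin f @: U)%:R * Phi (tperm p q @: (f @: U))) <=
  expectation (fun f : {ffun P -> 'I_#|P|} =>
    (p \notin f @: U)%:R * (q \in f @: U)%:R * Phi (f @: U)).
Proof.
move=> Phi0 pq.
rewrite (expectation_fibre (fun W => (p \in W)%:R * (q \notin W)%:R
  * Phi (tperm p q @: W))).
rewrite (expectation_fibre (fun W => (p \notin W)%:R * (q \in W)%:R * Phi W)).
apply: ler_wpM2r; first by rewrite invr_ge0.
have t_inj : injective (fun W : {set 'I_#|P|} => tperm p q @: W).
  exact/imset_inj/perm_inj.
rewrite [leRHS](reindex_inj t_inj) /=; apply: ler_sum => W _.
have mem_t z : (z \in tperm p q @: W) = (tperm p q z \in W).
  by rewrite -{1}(tpermK p q z) mem_imset //; exact: perm_inj.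
rewrite !mem_t tpermL tpermR [X in _ <= _ * (X * _)]mulrC.
have [pW|] := boolP (p \in W); last by rewrite !mul0r !mulr0.
have [qW|qW] := boolP (q \in W); first by rewrite /= !mulr0 !mul0r !mulr0.
by rewrite !mul1r ler_wpM2r // ler_nat card_fibre_swap.
Qed.

End UpSet.

Lemma natr_negb (R : pzRingType) (b : bool) : (~~ b)%:R = 1 - b%:R :> R.
Proof. by case: b; rewrite /= ?subr0 ?subrr. Qed.

Lemma sum_window (V : nmodType) (n a b : nat) (F : nat -> V) : (b <= n)%N ->
  \sum_(p < n | (a <= p < b)%N) F p = \sum_(a <= i < b) F i.
Proof.
move=> bn; rewrite (big_nat_widen a b n) // big_geq_mkord.
by apply: eq_bigl => p; rewrite andbC.
Qed.

(** * The decreasing test function *)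

Section Clamp.
Variables (R : realFieldType) (c rho : R).
Hypothesis c0 : 0 < c.

(** Constant up to [rho - c - 1], then of slope -1 until it vanishes at [rho + c]. The extra 1 makes
    a unit step ending within [c] of [rho] lose exactly 1. *)
Definition clamp (s : R) : R := Num.max 0 (Num.min (2 * c + 1) (rho + c - s)).

Lemma clamp_ge0 s : 0 <= clamp s.
Proof. by rewrite /clamp le_max lexx. Qed.

Lemma clamp_le s : clamp s <= 2 * c + 1.
Proof. by rewrite ge_max ge_min lexx andbT; move: c0; lra. Qed.

Lemma clampE s : [\/ rho + c - s <= 0 /\ clamp s = 0,
  0 <= rho + c - s <= 2 * c + 1 /\ clamp s = rho + c - s
  | 2 * c + 1 <= rho + c - s /\ clamp s = 2 * c + 1].
Proof.
have c1 := c0; rewrite /clamp; case: (lerP (2 * c + 1)) => h1.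
  by constructor 3; rewrite max_r //; lra.
case: (lerP 0 (rho + c - s)) => h2; last by constructor 1; rewrite ltW.
by constructor 2; rewrite ltW.
Qed.

Lemma clamp_step s : 0 <= clamp (s - 1) - clamp s <= 1.
Proof.
have c1 := c0.
by case: (clampE s) => -[h ->]; case: (clampE (s - 1)) => -[h' ->]; lra.
Qed.

(** The bound is linear in [|s - rho|], so a first absolute deviation is enough to bound the
    expected drop from below. *)
Lemma clamp_step_ge s : c - `|s - rho| <= c * (clamp (s - 1) - clamp s).
Proof.
have c1 := c0; have [far|near] := lerP c `|s - rho|.
  apply: le_trans (_ : 0 <= _); first lra.
  by have /andP[? _] := clamp_step s; rewrite mulr_ge0 // ltW.
have -> : clamp (s - 1) - clamp s = 1.
  move: near; rewrite ltr_norml => /andP[h1 h2].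
  by case: (clampE s) => -[h ->]; case: (clampE (s - 1)) => -[h' ->]; lra.
by rewrite mulr1 lerBlDr lerDl.
Qed.

End Clamp.

(** * Densities and counts of the positions of an up-set *)

Section Word.
Variables (R : realType) (d : Order.disp_t) (P : finPOrderType d) (U : {set P}).
Hypothesis U_up : forall x y : P, (x < y)%O -> x \in U -> y \in U.
Implicit Types (f : {ffun P -> 'I_#|P|}) (p q : 'I_#|P|).

Definition mark f p : R := (p \in f @: U)%:R.
Definition word_count a b f : R := \sum_(p < #|P| | (a <= p < b)%N) mark f p.
Definition density p : R := expectation (fun f => mark f p).

(** The exchange inequality with constant weight 1; the common event that both positions are marked
    cancels. *)
Lemma le_density p q : (p < q)%N -> density p <= density q.
Proof.
move=> pq; rewrite -subr_ge0 /density -expectationB.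
have := expectation_swap (R := R) U_up (Phi := fun=> 1) (fun=> ler01) pq.
rewrite -subr_ge0 -expectationB; congr (_ <= _).
by apply: eq_expectation => f _; rewrite !natr_negb /mark; ring.
Qed.

Lemma word_count_ge0 a b f : 0 <= word_count a b f.
Proof. by apply: sumr_ge0 => p _; rewrite ler0n. Qed.

Lemma word_count_negb a b f : (a <= b <= #|P|)%N ->
  \sum_(p < #|P| | (a <= p < b)%N) (1 - mark f p) = (b - a)%:R - word_count a b f.
Proof.
move=> /andP[ab bn]; rewrite sumrB; congr (_ - _).
by rewrite (sum_window a (fun=> 1)) // sumr_const_nat.
Qed.

Lemma word_count_le a b f : (a <= b <= #|P|)%N -> word_count a b f <= (b - a)%:R.
Proof.
move=> abn; rewrite -subr_ge0 -word_count_negb //.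
by apply: sumr_ge0 => p _; rewrite -natr_negb ler0n.
Qed.

Lemma word_countB a b f : (a <= b)%N -> word_count a b f = word_count 0 b f - word_count 0 a f.
Proof.
move=> ab; apply/eqP; rewrite eq_sym subr_eq; apply/eqP.
rewrite /word_count [LHS](bigID (fun p : 'I_#|P| => (p < a)%N)) /= addrC.
by congr (_ + _); apply: eq_bigl => p; lia.
Qed.

Lemma word_count_tperm b p q (W : {set 'I_#|P|}) :
    (p < b <= q)%N -> p \in W -> q \notin W ->
  \sum_(z < #|P| | (0 <= z < b)%N) (z \in tperm p q @: W)%:R =
  \sum_(z < #|P| | (0 <= z < b)%N) (z \in W)%:R - 1 :> R.
Proof.
move=> /andP[pb bq] pW qW.
rewrite (bigD1 p) //= [in RHS](bigD1 p) //= pW tperm_imset //.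
rewrite addrAC subrr add0r !inE eqxx -val_eqE /= ltn_eqF ?(leq_trans pb) // add0r.
apply: eq_bigr => z /andP[zb zp]; rewrite !inE zp -val_eqE.
by rewrite ltn_eqF // (leq_trans zb).
Qed.

(** The exchange inequality summed over [p] in the first window and [q] in the second. The left
    factors count the possible moves, the right ones the ways to undo a move, and a move across [b]
    lowers the count below [b] by 1. *)
Lemma window_swap a b c (phi : R -> R) : (forall s, 0 <= phi s) ->
    (a <= b <= c)%N -> (c <= #|P|)%N ->
  expectation (fun f => word_count a b f * ((c - b)%:R - word_count b c f)
                        * phi (word_count 0 b f - 1)) <=
  expectation (fun f => ((b - a)%:R - word_count a b f) * word_count b c f
                        * phi (word_count 0 b f)).
Proof.
move=> phi0 /andP[ab bc] cn; have bn := leq_trans bc cn.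
pose Phi (W : {set 'I_#|P|}) :=
  phi (\sum_(z < #|P| | (0 <= z < b)%N) (z \in W)%:R).
have -> : expectation (fun f => word_count a b f * ((c - b)%:R - word_count b c f)
                        * phi (word_count 0 b f - 1)) =
    \sum_(p < #|P| | (a <= p < b)%N) \sum_(q < #|P| | (b <= q < c)%N)
      expectation (fun f => (p \in f @: U)%:R * (q \notin f @: U)%:R
                            * Phi (tperm p q @: (f @: U))).
  under [RHS]eq_bigr => p _ do rewrite -expectation_sum.
  rewrite -expectation_sum; apply: eq_expectation => f _.
  rewrite -word_count_negb ?bc // big_distrlr mulr_suml /=; apply: eq_bigr => p /andP[_ pb].
  rewrite mulr_suml; apply: eq_bigr => q /andP[bq _].
  rewrite natr_negb /mark.
  have [pW|pW] := boolP (p \in _); last by rewrite !mul0r.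
  have [qW|qW] := boolP (q \in _); first by rewrite subrr !mulr0 !mul0r.
  by congr (_ * _); rewrite /Phi word_count_tperm ?pb.
have -> : expectation (fun f => ((b - a)%:R - word_count a b f) * word_count b c f
                        * phi (word_count 0 b f)) =
    \sum_(p < #|P| | (a <= p < b)%N) \sum_(q < #|P| | (b <= q < c)%N)
      expectation (fun f => (p \notin f @: U)%:R * (q \in f @: U)%:R
                            * Phi (f @: U)).
  under [RHS]eq_bigr => p _ do rewrite -expectation_sum.
  rewrite -expectation_sum; apply: eq_expectation => f _.
  rewrite -word_count_negb ?ab // big_distrlr mulr_suml /=; apply: eq_bigr => p _.
  by rewrite mulr_suml; apply: eq_bigr => q _; rewrite natr_negb.
apply: ler_sum => p /andP[_ pb]; apply: ler_sum => q /andP[bq _].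
apply: (expectation_swap U_up) => [W|]; first exact: phi0.
exact: leq_trans bq.
Qed.

Section Tight.
Variables (C : R) (r : nat -> R).
Hypothesis C0 : 0 < C.
Hypothesis tight : forall k, expectation (fun f => `|word_count 0 k f - r k|) <= C.

(** The two ends of the window cost [2 * C], and recentring at the mean costs as much again. *)
Lemma word_count_tight a b : (a <= b)%N ->
  expectation (fun f => `|word_count a b f - expectation (word_count a b)|) <= 4 * C.
Proof.
move=> ab; have C1 := C0; pose u f := word_count a b f - (r b - r a).
have Eu : expectation (fun f => `|u f|) <= 2 * C.
  apply: le_trans (_ : expectation (fun f => `|word_count 0 b f - r b| +
      `|word_count 0 a f - r a|) <= _); last first.
    by rewrite expectationD; move: (tight a) (tight b); lra.
  apply: ler_expectation => f _; rewrite /u word_countB //.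
  by rewrite (_ : _ - _ = (word_count 0 b f - r b) - (word_count 0 a f - r a)) ?ler_normB //; ring.
have Ecount : expectation (word_count a b) = expectation u + (r b - r a).
  by rewrite /u expectationB expectation_cst; ring.
have absE : `|expectation u| <= 2 * C := le_trans (normr_expectation _) Eu.
apply: le_trans (_ : expectation (fun f => `|u f| + `|expectation u|) <= _).
  apply: ler_expectation => f _; rewrite Ecount.
  by rewrite (_ : _ - _ = u f - expectation u) ?ler_normB // /u; ring.
by rewrite expectationD expectation_cst; lra.
Qed.

Lemma expectation_count a b :
  expectation (word_count a b) = \sum_(p < #|P| | (a <= p < b)%N) density p.
Proof. by rewrite /word_count expectation_sum. Qed.

(** The left side and the [hi - lo] term are of order [M ^ 2], the last term only of order [M]: over
    long windows the density cannot be both nearly constant and bounded away from 0 and 1. *)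
Lemma density_spread (a M : nat) (tau lo hi : R) :
    (a + M + M <= #|P|)%N -> 0 <= tau -> tau <= lo -> hi <= 1 - tau ->
    (forall p, (a <= p < a + M + M)%N -> lo <= density p <= hi) ->
  (tau * M%:R) ^+ 2 / 2 <=
    (4 * C + 1) * M%:R ^+ 2 * (hi - lo) + 8 * C * (4 * C + 2) * M%:R.
Proof.
move=> an tau0 tau_lo hi_tau dens; have C1 := C0; set b := (a + M)%N; set c := (b + M)%N.
have ab : (a <= b)%N := leq_addr _ _; have bc : (b <= c)%N := leq_addr _ _.
have bn : (b <= #|P|)%N := leq_trans bc an.
have Mb : (b - a)%N = M by rewrite /b addKn.
have Mc : (c - b)%N = M by rewrite /c addKn.
have mean_bounds l h : (a <= l)%N -> (h <= c)%N -> (h - l)%N = M ->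
    M%:R * lo <= expectation (word_count l h) <= M%:R * hi.
  move=> al hc hl; rewrite expectation_count.
  have sumM (e : R) : M%:R * e = \sum_(p < #|P| | (l <= p < h)%N) e.
    rewrite (sum_window l (fun=> e)) ?(leq_trans hc) // sumr_const_nat hl.
    by rewrite mulr_natl.
  rewrite !sumM; apply/andP; split; apply: ler_sum => p /andP[lp ph];
    have /andP[//] : lo <= density p <= hi by apply: dens; lia.
have /andP[uE_lo uE_hi] := mean_bounds a b (leqnn a) bc Mb.
have /andP[uL_lo uL_hi] := mean_bounds b c ab (leqnn c) Mc.
have dE := word_count_tight ab; have dL := word_count_tight bc.
set uE := expectation (word_count a b) in uE_lo uE_hi dE.
set uL := expectation (word_count b c) in uL_lo uL_hi dL.
(* The half-width [c2] makes the clamp drop by at least 1/2 in expectation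
   when the argument increases by 1. *)
set c2 := 2 * C; have c20 : 0 < c2 by rewrite /c2; lra.
set phi := clamp c2 (r b).
have M0 : 0 <= M%:R :> R by rewrite ler0n.
(* [g] is the error made when the two window counts are replaced by their means, and [A] below is
   the number of possible moves computed from the means. *)
pose g f := `|word_count a b f - uE| + `|word_count b c f - uL|.
have Eg : expectation g <= 8 * C by rewrite /g expectationD; lra.
have swap := window_swap (clamp_ge0 c2 (r b)) (introT andP (conj ab bc)) an.
rewrite Mb Mc -subr_le0 -expectationB -/phi in swap.
pose A := uE * (M%:R - uL).
have A_ge : (tau * M%:R) ^+ 2 <= A.
  have h1 : tau * M%:R <= uE by apply: le_trans uE_lo; rewrite mulrC ler_wpM2l.
  have h2 : tau * M%:R <= M%:R - uL.
    have : M%:R * hi <= M%:R * (1 - tau) by rewrite ler_wpM2l.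
    by lra.
  by rewrite expr2 ler_pM // mulr_ge0.
have uE0 : 0 <= uE by apply: le_trans uE_lo; rewrite mulr_ge0 //; lra.
have uLM : 0 <= M%:R - uL.
  have : M%:R * hi <= M%:R * 1 by rewrite ler_wpM2l //; lra.
  by lra.
have uL0 : 0 <= uL by apply: le_trans uL_lo; rewrite mulr_ge0 //; lra.
have A0 : 0 <= A by rewrite mulr_ge0.
have main : expectation (fun f => A * (1 - c2^-1 * `|word_count 0 b f - r b|)
    - M%:R * (2 * c2 + 2) * g f - M%:R * (2 * c2 + 1) * (M%:R * (hi - lo))) <= 0.
  apply: le_trans swap; apply: ler_expectation => f _.
  set u := word_count a b f; set v := word_count b c f; set s := word_count 0 b f.
  have u0 : 0 <= u := word_count_ge0 _ _ _.
  have v0 : 0 <= v := word_count_ge0 _ _ _.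
  have uM : u <= M%:R by rewrite -Mb word_count_le // ab.
  have vM : v <= M%:R by rewrite -Mc word_count_le // bc.
  (* The gain comes from the drop of [phi]; the loss comes from the second window holding more marks
     than the first. *)
  rewrite (_ : _ - _ * phi s = u * (M%:R - v) * (phi (s - 1) - phi s)
                              - M%:R * (v - u) * phi s); last by ring.
  have /andP[D0 D1] := clamp_step (r b) c20 s.
  have D_ge := clamp_step_ge (r b) c20 s.
  rewrite -/phi in D0 D1 D_ge; set D := phi (s - 1) - phi s in D0 D1 D_ge *.
  have D_ge' : 1 - c2^-1 * `|s - r b| <= D.
    by rewrite -(ler_pM2l c20) mulrBr mulrA divff ?gt_eqF // mul1r mulr1.
  have phis0 : 0 <= phi s := clamp_ge0 _ _ _.
  have phis_le : phi s <= 2 * c2 + 1 := clamp_le (r b) c20 s.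
  have gu : `|u - uE| + `|v - uL| = g f by [].
  have g0 : 0 <= g f by rewrite -gu addr_ge0.
  have first_le : A - M%:R * g f <= u * (M%:R - v).
    rewrite (_ : u * (M%:R - v) = A + (u - uE) * (M%:R - uL) - u * (v - uL));
      last by rewrite /A; ring.
    have h1 : - (`|u - uE| * M%:R) <= (u - uE) * (M%:R - uL).
      apply: le_trans (_ : - `|(u - uE) * (M%:R - uL)| <= _).
        by rewrite lerN2 normrM ler_wpM2l // ger0_norm //; lra.
      by rewrite lerNl -normrN ler_norm.
    have h2 : u * (v - uL) <= M%:R * `|v - uL|.
      apply: le_trans (ler_norm _) _; rewrite normrM (ger0_norm u0).
      by rewrite ler_wpM2r.
    by rewrite -gu; lra.
  have Mg0 : 0 <= M%:R * g f by rewrite mulr_ge0.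
  have part1 : A * (1 - c2^-1 * `|s - r b|) - M%:R * g f <= u * (M%:R - v) * D.
    apply: le_trans (_ : A * D - M%:R * g f * D <= _).
      by rewrite lerB // ?ler_wpM2l // -[leRHS]mulr1 ler_wpM2l.
    by rewrite -mulrBl ler_wpM2r.
  have vu : v - u <= g f + M%:R * (hi - lo).
    have h1 := ler_norm (v - uL).
    have h2 : uE - u <= `|u - uE| by rewrite distrC ler_norm.
    by rewrite -gu mulrBr; lra.
  have part2 : M%:R * (v - u) * phi s <=
      M%:R * (2 * c2 + 1) * (g f + M%:R * (hi - lo)).
    rewrite -!mulrA ler_wpM2l // mulrC.
    have hl0 : 0 <= M%:R * (hi - lo) by rewrite mulrBr; lra.
    apply: le_trans (_ : phi s * (g f + M%:R * (hi - lo)) <= _).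
      by rewrite ler_wpM2l.
    by rewrite ler_wpM2r // addr_ge0.
  rewrite mulrDr in part2.
  rewrite (_ : M%:R * (2 * c2 + 2) * g f =
    M%:R * g f + M%:R * (2 * c2 + 1) * g f); last by ring.
  by move: part1 part2; lra.
rewrite 2!expectationB expectation_cst in main.
rewrite (expectationZ A (fun f => 1 - c2^-1 * _)) expectationB in main.
rewrite (expectationZ _ g) expectation_cst expectationZ in main.
have Et : c2^-1 * expectation (fun f => `|word_count 0 b f - r b|) <= 1 / 2.
  by rewrite mulrC ler_pdivrMr // /c2; move: (tight b); lra.
have h1 : A * (1 / 2) <= A *
    (1 - c2^-1 * expectation (fun f => `|word_count 0 b f - r b|)).
  by rewrite ler_wpM2l //; lra.
have h2 : M%:R * (2 * c2 + 2) * expectation g <= M%:R * (2 * c2 + 2) * (8 * C).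
  by rewrite ler_wpM2l // mulr_ge0 //; lra.
move: main h1 h2 A_ge; rewrite /c2.
set EE := expectation _; set X := A * (1 - _); set Y := _ * expectation g.
by lra.
Qed.

End Tight.
End Word.

Lemma ler_sqr_norm (R : realDomainType) (x y : R) :
  `|x| <= `|y| -> x ^+ 2 <= y ^+ 2.
Proof. by rewrite -ler_sqr ?nnegrE // !real_normK ?num_real. Qed.

(** * Consequences of bounded variance *)

Section Concentration.
Variables (R : realType) (d : Order.disp_t) (P : finPOrderType d) (V : R).
Hypothesis V0 : 0 <= V.
Hypothesis varV : forall z : P, variance_height R z <= V.
Implicit Types f : {ffun P -> 'I_#|P|}.

Local Notation h := (mean_height R).
Local Notation H f z := ((height f z)%:R : R).

Lemma sum_kernel (n k : nat) :
  \sum_(0 <= j < n) (1 + (j.+1%:R - k%:R) ^+ 2)^-1 <= 8 :> R.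
Proof.
(* The increments of [G] along the integers dominate the kernel. *)
pose G (x : R) := 4 * (x / (1 + `|x|)).
have G_bounds x : -4 <= G x <= 4.
  have := ler_norm x; have := ler_norm (- x); rewrite normrN => h1 h2.
  have p0 : 0 < 1 + `|x| by rewrite ltr_pwDl.
  by rewrite /G mulrA ler_pdivlMr // ler_pdivrMr //; apply/andP; split; lra.
have step (j : nat) : (1 + (j.+1%:R - k%:R) ^+ 2)^-1 <=
    G (j.+2%:R - k%:R) - G (j.+1%:R - k%:R).
  (* On either side of [k] the increment is [4 / ((1 + x) * (2 + x))], where [x] is the distance
     from [k] to the nearer of the two points. *)
  have [kj|jk] := leqP k j.+1.
    rewrite -(subnK kj); set m := (j.+1 - k)%N; rewrite -addSn !natrD !addrK.
    have m0 : 0 <= m%:R :> R by [].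
    rewrite /G !ger0_norm // -(natr1 m); move: (m%:R) m0 => x x0.
    have e1 : 1 + x != 0 by lra.
    have e2 : 1 + (x + 1) != 0 by lra.
    rewrite (_ : _ - _ = 4 / ((1 + x) * (1 + (x + 1)))); last by field; rewrite e1 e2.
    have q1 : 0 < (1 + x) * (1 + (x + 1)) by rewrite mulr_gt0 //; lra.
    have q2 : 0 < 1 + x ^+ 2 by rewrite ltr_pwDl // sqr_ge0.
    rewrite ler_pdivlMr // mulrC ler_pdivrMr //.
    by have := sqr_ge0 (x - 1 / 2); rewrite !expr2; lra.
  rewrite -(subnKC jk); set m := (k - j.+2)%N.
  rewrite natrD -(natr1 j.+1).
  have m0 : 0 <= m%:R :> R by [].
  rewrite /G (_ : j.+1%:R + 1 - (j.+1%:R + 1 + m%:R) = - m%:R :> R); last by ring.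
  rewrite (_ : j.+1%:R - (j.+1%:R + 1 + m%:R) = - (m%:R + 1) :> R); last by ring.
  rewrite !normrN !ger0_norm ?addr_ge0 //; move: (m%:R) m0 => x x0.
  have e1 : 1 + x != 0 by lra.
  have e2 : 1 + (x + 1) != 0 by lra.
  rewrite (_ : _ - _ = 4 / ((1 + x) * (1 + (x + 1)))); last by field; rewrite e1 e2.
  have q1 : 0 < (1 + x) * (1 + (x + 1)) by rewrite mulr_gt0 //; lra.
  have q2 : 0 < 1 + (- (x + 1)) ^+ 2 by rewrite ltr_pwDl // sqr_ge0.
  rewrite ler_pdivlMr // mulrC ler_pdivrMr //.
  by have := sqr_ge0 x; rewrite !expr2; lra.
apply: le_trans (ler_sum _ (fun j _ => step j)) _.
rewrite (telescope_sumr (fun j => G (j.+1%:R - k%:R))) //.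
by have /andP[? ?] := G_bounds (n.+1%:R - k%:R);
   have /andP[? ?] := G_bounds (1%:R - k%:R); lra.
Qed.

(** A summable substitute for the probability that [z] has height near [k]. *)
Definition kernel (k : nat) (z : P) : R :=
  expectation (fun f => (1 + (H f z - k%:R) ^+ 2)^-1).

(** The heights of each linear extension run once through 1, ..., n, so the bound holds before
    averaging. *)
Lemma sum_expected_kernel k : \sum_z kernel k z <= 8.
Proof.
rewrite -expectation_sum -[leRHS](expectation_cst P).
apply: ler_expectation => f; rewrite inE => /linear_extensionP[[g fK gK] _].
rewrite (reindex g) /=; last by exists f => ? _; rewrite ?fK ?gK.
under eq_bigr => j _ do rewrite /height gK.
by rewrite -(big_mkord predT (fun j => (1 + (j.+1%:R - k%:R) ^+ 2)^-1)) sum_kernel.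
Qed.

Lemma second_moment (z : P) (k : R) :
  expectation (fun f => (H f z - k) ^+ 2) =
  variance_height R z + (h z - k) ^+ 2.
Proof.
transitivity (expectation (fun f => (H f z - h z) ^+ 2 +
    (2 * (h z - k) * (H f z - h z) + (h z - k) ^+ 2))).
  by apply: eq_expectation => f _; ring.
rewrite expectationD; congr (_ + _).
rewrite expectationD expectationZ expectationB !expectation_cst.
by rewrite -/(h z) subrr mulr0 add0r.
Qed.

Lemma kernel_ge (k : nat) (z : P) : (1 + V + (h z - k%:R) ^+ 2)^-1 <= kernel k z.
Proof.
set m := 1 + V + _.
have V1 := V0.
have m0 : 0 < m by rewrite /m -addrA ltr_pwDl // addr_ge0 // sqr_ge0.
(* Tangent line of the convex function [1 / x] at [m]. *)
apply: le_trans (_ : expectation (fun f => 2 * m^-1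
    - m^-1 ^+ 2 * (1 + (H f z - k%:R) ^+ 2)) <= _).
  rewrite expectationB expectation_cst expectationZ expectationD expectation_cst second_moment.
  have le_m : 1 + (variance_height R z + (h z - k%:R) ^+ 2) <= m.
    by rewrite /m; move: (varV z); lra.
  have : m^-1 ^+ 2 * (1 + (variance_height R z + (h z - k%:R) ^+ 2)) <= m^-1 ^+ 2 * m.
    by rewrite ler_wpM2l // sqr_ge0.
  by rewrite expr2 -[X in _ <= X]mulrA mulVf ?gt_eqF // mulr1; lra.
apply: ler_expectation => f _.
have x0 : 0 < 1 + (H f z - k%:R) ^+ 2 by rewrite ltr_pwDl // sqr_ge0.
move: (1 + _) x0 => x x0.
rewrite -subr_ge0 (_ : _ - _ = x * (x^-1 - m^-1) ^+ 2).
  by rewrite mulr_ge0 ?sqr_ge0 // ltW.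
by field; rewrite !gt_eqF.
Qed.

(** Each element counted takes a fixed share of the total kernel mass 8. Rounding [h x] down to [k]
    turns [D] into [D + 1]. *)
Lemma card_near (x : P) (D : R) : 0 <= D ->
  #|[set y : P | `|h y - h x| <= D]|%:R <= 8 * (1 + V + (D + 1) ^+ 2).
Proof.
move=> D0; have V1 := V0.
have hx0 : 0 <= h x.
  by rewrite -(expectation_cst P 0); apply: ler_expectation => f _.
set k := Num.truncn (h x).
have /andP[k_le k_gt] : k%:R <= h x < k.+1%:R := truncn_itv hx0.
have p0 : 0 < 1 + V + (D + 1) ^+ 2.
  by rewrite -addrA ltr_pwDl // addr_ge0 // sqr_ge0.
rewrite -ler_pdivrMr //; apply: le_trans (sum_expected_kernel k).
rewrite mulr_natl -sumr_const [leRHS](bigID (mem [set y : P | `|h y - h x| <= D])) /=.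
rewrite -[leLHS]addr0 lerD //; last first.
  apply: sumr_ge0 => z _; apply: le_trans (kernel_ge k z).
  by rewrite invr_ge0 -addrA addr_ge0 // addr_ge0 // sqr_ge0.
apply: ler_sum => z; rewrite inE => near; apply: le_trans (kernel_ge k z).
have q0 : 0 < 1 + V + (h z - k%:R) ^+ 2.
  by rewrite -addrA ltr_pwDl // addr_ge0 // sqr_ge0.
rewrite lef_pV2 ?posrE // lerD2l; apply: ler_sqr_norm.
rewrite [leRHS]ger0_norm ?addr_ge0 //.
by move: near k_gt; rewrite !ler_norml -natr1 => /andP[? ?] ?; apply/andP; lra.
Qed.

(** When the two indicators differ, [k] separates the height from its mean, so the height deviates
    by at least [|h z - k|]. Markov's inequality then gives a bound that can be summed over [z]. *)
Lemma indicator_deviation (k : nat) (z : P) :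
  expectation (fun f => `|(height f z <= k)%N%:R - (h z <= k%:R)%R%:R|) <=
  (1 + 2 * V) * kernel k z.
Proof.
have V1 := V0.
set m := 1 + V + (h z - k%:R) ^+ 2.
have m0 : 0 < m by rewrite /m -addrA ltr_pwDl // addr_ge0 // sqr_ge0.
apply: le_trans (_ : (1 + 2 * V) * m^-1 <= _); last first.
  by rewrite ler_wpM2l ?kernel_ge //; lra.
rewrite ler_pdivlMr // mulrC -expectationZ.
apply: le_trans (_ : expectation (fun f => 1 + V + (H f z - h z) ^+ 2) <= _).
  apply: ler_expectation => f _; rewrite -(ler_nat R).
  have sq0 := sqr_ge0 (H f z - h z).
  have [h1|h1] := lerP (H f z) k%:R; have [h2|h2] := lerP (h z) k%:R;
    rewrite ?subrr ?normr0 ?mulr0 ?subr0 ?sub0r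
    ?normrN ?normr1 ?mulr1 ?addr_ge0 // /m lerD2l.
    by apply: ler_sqr_norm; rewrite gtr0_norm ?ler0_norm; lra.
  by apply: ler_sqr_norm; rewrite ler0_norm ?gtr0_norm; lra.
rewrite expectationD expectation_cst -/(variance_height R z).
by move: (varV z); lra.
Qed.

(** Chebyshev's inequality about [k], where the second moment is at most [V + 1]. *)
Lemma deviation_near (x : P) (k w : nat) :
    `|h x - k%:R| <= 1 -> 2 * (V + 1) <= w%:R ^+ 2 ->
  1 / 2 <= expectation (fun f => (`|H f x - k%:R| <= w%:R)%R%:R : R).
Proof.
move=> xk w_ge; have V1 := V0.
have w0 : 0 < w%:R ^+ 2 :> R by lra.
apply: le_trans (_ : expectation (fun f => 1 - (w%:R ^+ 2)^-1 * (H f x - k%:R) ^+ 2) <= _).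
  rewrite expectationB expectation_cst expectationZ second_moment.
  rewrite lerBrDl -lerBrDr mulrC ler_pdivrMr //.
  have := varV x; have : (h x - k%:R) ^+ 2 <= 1.
    by rewrite -[leRHS](expr1n _ 2) ler_sqr_norm // normr1.
  by lra.
apply: ler_expectation => f _.
have [near|far] := lerP `|H f x - k%:R| w%:R.
  by rewrite lerBlDr lerDl mulr_ge0 ?sqr_ge0 // invr_ge0 ltW.
rewrite subr_le0 mulrC ler_pdivlMr // mul1r; apply: ler_sqr_norm.
by rewrite [leLHS]ger0_norm // ltW.
Qed.

Section Up.
Variable U : {set P}.

Lemma below_tight k :
  expectation (fun f => `|\sum_(z in U) (height f z <= k)%N%:R
     - \sum_(z in U) (h z <= k%:R)%R%:R|) <= 8 * (1 + 2 * V).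
Proof.
apply: le_trans (_ : \sum_(z in U) (1 + 2 * V) * kernel k z <= _).
  apply: le_trans (_ : expectation (fun f => \sum_(z in U)
     `|(height f z <= k)%N%:R - (h z <= k%:R)%R%:R|) <= _).
    by apply: ler_expectation => f _; rewrite -sumrB ler_norm_sum.
  by rewrite expectation_sum; apply: ler_sum => z _; apply: indicator_deviation.
rewrite -mulr_sumr [leRHS]mulrC.
have V1 := V0.
rewrite ler_wpM2l //; first lra.
apply: le_trans (sum_expected_kernel k).
rewrite [leRHS](bigID (mem U)) /= lerDl; apply: sumr_ge0 => z _.
apply: le_trans (kernel_ge k z).
by rewrite invr_ge0 -addrA addr_ge0 // addr_ge0 // sqr_ge0.
Qed.

End Up.
End Concentration.

Lemma sum_window_cst_le (R : numDomainType) (n a b : nat) (c : R) : 0 <= c ->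
  \sum_(p < n | (a <= p < b)%N) c <= (b - a)%:R * c.
Proof.
move=> c0; rewrite (eq_bigl (fun p : 'I_n => (a <= p < minn b n)%N)); last first.
  by move=> p; rewrite leq_min ltn_ord andbT.
rewrite (sum_window a (fun=> c)) ?geq_minr // sumr_const_nat -[c *+ _]mulr_natl.
by rewrite ler_wpM2r // ler_nat leq_sub2r // geq_minl.
Qed.

(** Otherwise the increments would telescope to more than 1. *)
Lemma small_increment (R : realFieldType) (T : nat) (t : nat -> R) :
  (0 < T)%N -> t T - t 0%N <= 1 -> exists2 i, (i < T)%N & t i.+1 - t i <= T%:R^-1.
Proof.
move=> T0 tT; case: (boolP [exists i : 'I_T, t i.+1 - t i <= T%:R^-1]).
  by move=> /existsP[i ti]; exists i.
rewrite negb_exists => /forallP big_t.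
have : \sum_(i < T) T%:R^-1 < \sum_(i < T) (t i.+1 - t i).
  apply: ltr_sum => [|i _]; last by rewrite ltNge.
  by apply/hasP; exists (Ordinal T0); rewrite ?mem_index_enum.
rewrite sumr_const card_ord -[_ *+ T]mulr_natl divff ?pnatr_eq0 -?lt0n //.
rewrite -(big_mkord predT (fun i => t i.+1 - t i)) telescope_sumr //.
by move=> /lt_le_trans/(_ tT); rewrite ltxx.
Qed.

(** * Bounds on the density from single elements *)

Section Density.
Variables (R : realType) (d : Order.disp_t) (P : finPOrderType d) (U : {set P}).
Variable V : R.
Hypothesis U_up : forall x y : P, (x < y)%O -> x \in U -> y \in U.
Hypothesis V0 : 0 <= V.
Hypothesis varV : forall z : P, variance_height R z <= V.

Local Notation h := (mean_height R).

Lemma leq_density (p q : 'I_#|P|) : (p <= q)%N -> density R U p <= density R U q.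
Proof.
rewrite leq_eqVlt => /predU1P[/val_inj -> //|]; exact: le_density.
Qed.

Lemma density_bounds (p : 'I_#|P|) : 0 <= density R U p <= 1.
Proof.
apply/andP; split; [rewrite -(expectation_cst P 0)|rewrite -(expectation_cst P 1)];
  by apply: ler_expectation => f _; rewrite /mark ?ler0n // lern1 leq_b1.
Qed.

(** Positions start at 0 and heights at 1, so a position below [k] is a height at most [k]. *)
Lemma word_count_height (k : nat) f : f \in linear_extensions P ->
  word_count R U 0 k f = \sum_(z in U) (height f z <= k)%N%:R.
Proof.
rewrite inE => /linear_extensionP[/bij_inj f_inj _].
rewrite /word_count /mark big_mkcond /=.
transitivity (\sum_(p in f @: U) (p < k)%N%:R : R).
  rewrite [RHS]big_mkcond; apply: eq_bigr => p _.
  by case: (p < k)%N; case: (p \in _).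
by rewrite big_imset //= => ? ? _ _; apply: f_inj.
Qed.

Lemma word_count_below_tight k :
  expectation (fun f => `|word_count R U 0 k f - \sum_(z in U) (h z <= k%:R)%R%:R|)
    <= 8 * (1 + 2 * V).
Proof.
apply: le_trans (below_tight V0 varV U k); apply: ler_expectation => f fP.
by rewrite word_count_height.
Qed.

Lemma near_position (f : {ffun P -> 'I_#|P|}) (x : P) (k w : nat) :
  `|(height f x)%:R - k%:R| <= w%:R :> R -> (k - w.+1 <= f x < k + w)%N.
Proof.
rewrite ler_norml => /andP[h1 h2].
have : (height f x <= k + w)%N by rewrite -(ler_nat R) natrD; lra.
have : (k <= height f x + w)%N by rewrite -(ler_nat R) natrD; lra.
by rewrite /height; lia.
Qed.

(** With probability at least 1/2, [x] marks one of at most [2 * w + 1] positions near [k]. The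
    densities there sum to at least 1/2, and by monotonicity none exceeds the density at [p]. *)
Lemma density_ge (x : P) (k w : nat) (p : 'I_#|P|) : x \in U ->
    `|h x - k%:R| <= 1 -> 2 * (V + 1) <= w%:R ^+ 2 -> (k + w <= p)%N ->
  (2 * (2 * w + 1)%:R)^-1 <= density R U p.
Proof.
move=> xU xk Vw kp.
have half : 1 / 2 <= (2 * w + 1)%:R * density R U p.
  apply: le_trans (deviation_near V0 varV xk Vw) _.
  have /andP[p0 _] := density_bounds p.
  apply: le_trans (_ : (k + w - (k - w.+1))%:R * density R U p <= _); last first.
    by rewrite ler_wpM2r // ler_nat; lia.
  apply: le_trans (sum_window_cst_le #|P| _ _ p0).
  apply: le_trans (_ : \sum_(q < #|P| | (k - w.+1 <= q < k + w)%N) density R U q <= _);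
    last first.
    by apply: ler_sum => q /andP[_ qk]; apply: leq_density; lia.
  rewrite -expectation_count; apply: ler_expectation => f _.
  have [near|_] := boolP (`|(height f x)%:R - k%:R| <= w%:R :> R); last by rewrite mulr0n word_count_ge0.
  rewrite /word_count (bigD1 (f x)) ?near_position //= /mark imset_f //.
  by rewrite lerDl sumr_ge0.
have c0 : 0 < (2 * w + 1)%:R :> R by rewrite addn1 ltr0n.
by rewrite -[leLHS]mul1r ler_pdivrMr ?mulr_gt0 //; lra.
Qed.

(** The mirror argument: [y] leaves unmarked a position near [k], and unmarked positions become less
    likely to the right of [p]. *)
Lemma density_le (y : P) (k w : nat) (p : 'I_#|P|) : y \notin U ->
    `|h y - k%:R| <= 1 -> 2 * (V + 1) <= w%:R ^+ 2 -> (p <= k - w.+1)%N ->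
  density R U p <= 1 - (2 * (2 * w + 1)%:R)^-1.
Proof.
move=> yU yk Vw pk; rewrite lerBrDl -lerBrDr.
have half : 1 / 2 <= (2 * w + 1)%:R * (1 - density R U p).
  apply: le_trans (deviation_near V0 varV yk Vw) _.
  have p1 : 0 <= 1 - density R U p.
    by have /andP[_] := density_bounds p; rewrite subr_ge0.
  apply: le_trans (_ : (k + w - (k - w.+1))%:R * (1 - density R U p) <= _); last first.
    by rewrite ler_wpM2r // ler_nat; lia.
  apply: le_trans (sum_window_cst_le #|P| _ _ p1).
  apply: le_trans (_ : \sum_(q < #|P| | (k - w.+1 <= q < k + w)%N)
      expectation (fun f => 1 - mark R U f q) <= _); last first.
    apply: ler_sum => q /andP[qk _].
    rewrite expectationB expectation_cst lerB // leq_density //.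
    exact: leq_trans qk.
  rewrite -expectation_sum; apply: ler_expectation => f.
  rewrite inE => /linear_extensionP[/bij_inj f_inj _].
  have mark0 q : 0 <= 1 - mark R U f q by rewrite /mark -natr_negb.
  have [near|_] := boolP (`|(height f y)%:R - k%:R| <= w%:R :> R); last by apply: sumr_ge0 => q _.
  rewrite (bigD1 (f y)) ?near_position //= /mark mem_imset // (negPf yU) subr0.
  by rewrite lerDl; apply: sumr_ge0 => q _; exact: mark0.
have c0 : 0 < (2 * w + 1)%:R :> R by rewrite addn1 ltr0n.
by rewrite -[leLHS]mul1r ler_pdivrMr ?mulr_gt0 //; lra.
Qed.

End Density.

(** * Mean heights of incomparable elements, and the conclusion *)

(** The bound is one-sided; an incomparable pair satisfies it in both orders. [U] is the principal
    up-set of [x], which omits [y]. *)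
Lemma incomparable_near (R : realType) (V : R) : 0 <= V ->
  exists2 D : R, 0 <= D & forall (d : Order.disp_t) (P : finPOrderType d),
    (forall z : P, variance_height R z <= V) ->
    forall x y : P, ~~ (x <= y)%O -> mean_height R y - mean_height R x <= D.
Proof.
move=> V0.
pose w := Num.bound (2 * (V + 1)).
have w_gt : 2 * (V + 1) < w%:R by apply: archi_boundP; lra.
have Vw : 2 * (V + 1) <= w%:R ^+ 2.
  apply: le_trans (ltW w_gt) _; rewrite expr2 ler_peMr // ; lra.
(* [tau] bounds the densities away from 0 and 1, [C] bounds the fluctuation of
   the counts, and [T] blocks of two windows of length [M] fit between [x] and
   [y], so that some block has density increment at most [1 / T]. *)
pose tau : R := (2 * (2 * w + 1)%:R)^-1.
have tau0 : 0 < tau by rewrite invr_gt0 mulr_gt0 // ltr0n addn1.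
pose C : R := 8 * (1 + 2 * V).
have C0 : 0 < C by rewrite /C; lra.
pose T := (Num.bound (4 * (4 * C + 1) / tau ^+ 2)).+1.
have T_gt : 4 * (4 * C + 1) / tau ^+ 2 < T%:R.
  apply: lt_trans (archi_boundP _) _; last by rewrite ltr_nat.
  by rewrite divr_ge0 ?sqr_ge0 //; lra.
pose M := Num.bound (32 * C * (4 * C + 2) / tau ^+ 2).
have M_gt : 32 * C * (4 * C + 2) / tau ^+ 2 < M%:R.
  by apply: archi_boundP; rewrite divr_ge0 ?sqr_ge0 // mulr_ge0 //; lra.
(* A margin [w] is kept at each end for the density bounds; the final 2 absorbs rounding and the
   offset between heights and positions. *)
exists (2 * w + T * (2 * M) + 2)%:R => // d P varV x y xy.
rewrite leNgt; apply/negP => far.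
pose U := [set z : P | (x <= z)%O].
have U_up a b : (a < b)%O -> a \in U -> b \in U.
  by rewrite !inE => ab xa; apply: le_trans (ltW ab).
have h0 (z : P) : 0 <= mean_height R z.
  by rewrite -(expectation_cst P 0); apply: ler_expectation => f _.
have hn (z : P) : mean_height R z <= #|P|%:R.
  rewrite -[leRHS](expectation_cst P); apply: ler_expectation => f _.
  by rewrite ler_nat; apply: ltn_ord.
pose k (z : P) := Num.truncn (mean_height R z).
have k_itv z : (k z)%:R <= mean_height R z < (k z).+1%:R := truncn_itv (h0 z).
have k_near z : `|mean_height R z - (k z)%:R| <= 1.
  have /andP[k1] := k_itv z; rewrite -natr1 => k2.
  by rewrite ger0_norm; lra.
have k_gap : (k x + (2 * w + T * (2 * M) + 2) < (k y).+1)%N.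
  rewrite -(ltr_nat R) natrD; have /andP[kx _] := k_itv x; have /andP[_ ky] := k_itv y.
  by lra.
have kyn : (k y <= #|P|)%N.
  by rewrite -(ler_nat R); apply: le_trans (hn y); have /andP[] := k_itv y.
pose pos i := (k x + w + i * (2 * M))%N.
have pos_le i : (i <= T)%N -> (pos i <= k y - w.+1)%N.
  by move=> iT; have := leq_mul2r (2 * M) i T; rewrite iT orbT /pos; lia.
have pos_lt i : (i <= T)%N -> (pos i < #|P|)%N.
  by move=> /pos_le; lia.
(* The default [enum_rank x] is not reached for [i <= T], where [pos i] is a valid position. *)
pose t i := density R U (insubd (enum_rank x) (pos i)).
have val_pos i : (i <= T)%N -> insubd (enum_rank x) (pos i) = pos i :> nat.
  by move=> iT; rewrite val_insubd pos_lt.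
have [i iT ti] : exists2 i, (i < T)%N & t i.+1 - t i <= T%:R^-1.
  apply: small_increment => //.
  have /andP[? ?] := density_bounds R U (insubd (enum_rank x) (pos 0%N)).
  have /andP[? ?] := density_bounds R U (insubd (enum_rank x) (pos T)).
  by rewrite /t; lra.
have posS : pos i.+1 = (pos i + M + M)%N by rewrite /pos mulSn; lia.
have spread := density_spread (R := R) U_up C0
  (word_count_below_tight U V0 varV) (a := pos i) (M := M) (tau := tau)
  (lo := t i) (hi := t i.+1).
have {spread} : (tau * M%:R) ^+ 2 / 2 <=
    (4 * C + 1) * M%:R ^+ 2 * (t i.+1 - t i) + 8 * C * (4 * C + 2) * M%:R.
  apply: spread.
  - by rewrite -posS ltnW // pos_lt.
  - exact: ltW.
  - apply: (density_ge U_up V0 varV (x := x) (k := k x)) => //; first by rewrite inE.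
    by rewrite val_pos ?(ltnW iT) // leq_addr.
  - apply: (density_le U_up V0 varV (y := y) (k := k y)) => //; first by rewrite inE.
    by rewrite val_pos // pos_le.
  move=> p; rewrite -posS => /andP[p1 p2]; apply/andP; split; apply: leq_density => //.
    by rewrite val_pos ?(ltnW iT).
  by rewrite val_pos // ltnW.
have M0 : 0 < M%:R :> R.
  apply: le_lt_trans M_gt; rewrite divr_ge0 ?sqr_ge0 // mulr_ge0 //; lra.
have T0 : 0 < T%:R :> R by rewrite ltr0n.
have tau20 : 0 < tau ^+ 2 by rewrite exprn_gt0.
move: M_gt T_gt; rewrite !ltr_pdivrMr // => M_gt T_gt.
(* By the choice of [T] and [M], each term on the right is at most [(tau * M) ^ 2 / 4], the second
   strictly, while the left side is [(tau * M) ^ 2 / 2]. *)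
have b1 : (4 * C + 1) * M%:R ^+ 2 * (t i.+1 - t i) <= M%:R ^+ 2 * (tau ^+ 2 / 4).
  apply: le_trans (_ : (4 * C + 1) * M%:R ^+ 2 * T%:R^-1 <= _).
    by rewrite ler_wpM2l // mulr_ge0 ?sqr_ge0 //; lra.
  rewrite [_ * M%:R ^+ 2]mulrC -mulrA ler_wpM2l ?sqr_ge0 //.
  by rewrite ler_pdivrMr //; lra.
have b2 : 8 * C * (4 * C + 2) * M%:R < M%:R ^+ 2 * (tau ^+ 2 / 4).
  by rewrite mulrC [M%:R ^+ 2]expr2 -[X in _ < X]mulrA ltr_pM2l //; lra.
rewrite exprMn leNgt => /negP; apply.
by lra.
Qed.

Theorem theorem1p3 (R : realType) (L : R) :
  exists K : nat, forall (d : Order.disp_t) (P : finPOrderType d),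
    (K < pi_poset P)%N -> L < sigma_poset P R.
Proof.
have V0 : 0 <= L ^+ 2 := sqr_ge0 L.
have [D D0 near] := incomparable_near V0.
exists (Num.bound (8 * (1 + L ^+ 2 + (D + 1) ^+ 2))) => d P.
set K := Num.bound _.
have K_gt : 8 * (1 + L ^+ 2 + (D + 1) ^+ 2) < K%:R.
  by apply: archi_boundP; rewrite mulr_ge0 // !addr_ge0 // sqr_ge0.
(* If all deviations are at most [L], every element incomparable to [x] has mean height within [D]
   of that of [x], and fewer than [K] elements do. *)
apply: contraTT; rewrite -leNgt -leqNgt => sigma_le.
have varL (z : P) : variance_height R z <= L ^+ 2.
  have var0 : 0 <= variance_height R z.
    by rewrite -(expectation_cst P 0); apply: ler_expectation => f _; apply: sqr_ge0.
  have sL : sigma_elt R z <= L by apply: le_trans sigma_le; apply: le_bigmax.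
  rewrite -(sqr_sqrtr var0) lerXn2r ?nnegrE ?sqrtr_ge0 //.
  (* [L] is nonnegative because it bounds a standard deviation. *)
  by apply: le_trans sL; apply: sqrtr_ge0.
apply/bigmax_leqP => x _; rewrite -(ler_nat R).
apply: le_trans (ltW K_gt); apply: le_trans (card_near V0 varL x D0).
rewrite ler_nat; apply/subset_leq_card/subsetP => y.
rewrite !inE /Order.comparable negb_or => /andP[xy yx].
rewrite ler_norml; apply/andP; split; last exact: near.
by rewrite lerNl opprB; apply: near.
Qed.
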